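(* Let $d\ge 1$, $r\ge 1$ and $0\le e<d$ be integers. Then, as formal power series in $x$, $$\sum_{n\ge 0}\mu(Q_{dn+e}(dr,d,d))\cdot\frac{x^n\,e!\,d^n}{(dn+e)!\,r^{(d-1)n}}=-\left(\sum_{n\ge 0}\frac{x^n\,e!\,d^n}{(dn+e)!\,r^{(d-1)n}}\right)\left(\sum_{n\ge 0}\frac{x^n d^n r^n}{(n!)^{d}}\right)^{-\frac{1}{dr}}.$$
   Context: For a finite bounded poset $P$, $\mu(P)=\mu_P(\hat 0,\hat 1)$, where $\mu_P$ is the Möbius function: $\mu_P(x,x)=1$, $\mu_P(x,y)=-\sum_{x\le z<y}\mu_P(x,z)$ for $x<y$, and $\mu_P(x,y)=0$ otherwise. Dowling lattices. Write $[N]=\{1,\dots,N\}$, and identify the group $\mu_s$ of complex $s$-th roots of unity with $\mathbb{Z}/s\mathbb{Z}$. A $\mu_s$-prepartition is a triple $(I,\pi,\lambda)$, where $I\subseteq[N]$ (the zero block, possibly empty), $\pi=B_1\mid\cdots\mid B_l$ is a partition of $[N]\setminus I$ into nonempty blocks (the nonzero blocks), and $\lambda:[N]\setminus I\to\mu_s$ is a map. Two prepartitions are equivalent if they have the same $I$ and the same $\pi$ and, for each block $B_i$, their labellings restricted to $B_i$ differ by multiplication by a constant of $\mu_s$ (depending on the block). The elements of $Q_N(s)$ are the equivalence classes. The partial order is generated by the covering relations: $\alpha$ is covered by $\beta$ if $\beta$ is obtained from $\alpha$ either by merging a nonzero block $B_i$ into the zero block, or by merging two nonzero blocks $B_i,B_j$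 into one block $B_i\cup B_j$ with labelling $\lambda$ on $B_i$ and $\lambda\cdot g$ on $B_j$ for some $g\in\mu_s$. The minimum $\hat 0$ of $Q_N(s)$ has $I=\emptyset$ and all nonzero blocks singletons; the maximum $\hat 1$ has $I=[N]$. For $k\mid s$ and $k\mid d$, $Q_N(s,d,k)$ is the subposet of $Q_N(s)$ consisting of $\hat 0$ together with the elements all of whose nonzero blocks $B_i$ have size divisible by $d$ and are such that $|\{a\in B_i\mid\lambda(a)\equiv j\pmod k\}|$ is independent of $j$. The case $d=1$ is allowed; then $Q_N(s,1,1)=Q_N(s)$. Convention when $n=e=0$: $Q_0(dr,d,d)$ is taken to be the two-element chain (a one-element poset with a minimum adjoined), so $\mu(Q_0(dr,d,d))=-1$.
   Formalization: For d=1 the identity fails as stated (coefficient of x: μ(Q_1(r)) = −1 on the left, 0 on the right), so for d=1 the formal theorem uses Q_n(r) with a new minimum adjoined, as in the n=e=0 convention; for d≥2 the posets are as stated. *)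

(* Defs.v *)
From HB Require Import structures.
From mathcomp Require Import all_boot all_order all_algebra.

Set Implicit Arguments.
Unset Strict Implicit.
Unset Printing Implicit Defensive.

Import Order.TTheory GRing.Theory Num.Theory.

Local Open Scope ring_scope.
Local Open Scope quotient_scope.

(* Moebius function. Chains of a finite poset have at most #|T| elements, so  *)
(* the fuel #|T| is enough: mobius satisfies the usual recursion (mobius_id,  *)
(* mobius_lt, mobius_nle).                                                    *)
Section Mobius.

Context {disp : Order.disp_t} {T : finPOrderType disp}.

Fixpoint mobius_rec (n : nat) (x y : T) : int :=
  if n is m.+1 then
    if x == y then 1
    else if (x < y)%O then - \sum_(z : T | (x <= z < y)%O) mobius_rec m x z
    else 0
  else 0.

Definition mobius (x y : T) : int := mobius_rec #|T| x y.

Lemma mobius_rec_stable m n (x y : T) :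
  (#|[set z | (x <= z <= y)%O]| <= m)%N ->
  (#|[set z | (x <= z <= y)%O]| <= n)%N -> mobius_rec m x y = mobius_rec n x y.
Proof.
have itv0 w z : (#|[set t : T | (w <= t <= z)%O]| <= 0)%N -> (w <= z)%O = false.
  rewrite leqn0 cards_eq0 => /eqP E; apply/negP => wz.
  by have := in_set0 z; rewrite -E inE wz lexx.
elim: m n y => [|m IH] [|n] y //=.
- by move=> /itv0 xy _; case: eqP xy => [->|_]; rewrite ?lexx // lt_neqAle => ->;
    rewrite andbF.
- by move=> _ /itv0 xy; case: eqP xy => [->|_]; rewrite ?lexx // lt_neqAle => ->;
    rewrite andbF.
move=> hm hn; case: eqP => // _; case: ifP => // xy; congr (- _).
apply: eq_bigr => z /andP[xz zy].
have card_lt : (#|[set t | (x <= t <= z)%O]| < #|[set t | (x <= t <= y)%O]|)%N.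
  apply: proper_card; apply/properP; split.
    apply/subsetP => t; rewrite !inE => /andP[-> /= tz].
    exact: le_trans tz (ltW zy).
  exists y; rewrite !inE ?lexx ?(ltW xy) //=.
  by rewrite lt_geF.
by apply: IH; rewrite -ltnS (leq_trans card_lt).
Qed.

Lemma mobius_id (x : T) : mobius x x = 1.
Proof.
rewrite /mobius; have: (0 < #|T|)%N by apply/card_gt0P; exists x.
by case: #|T| => //= n _; rewrite eqxx.
Qed.

Lemma mobius_lt (x y : T) : (x < y)%O ->
  mobius x y = - \sum_(z : T | (x <= z < y)%O) mobius x z.
Proof.
move=> xy; rewrite /mobius -(@mobius_rec_stable #|T|.+1 #|T| x y);
  rewrite ?max_card //; last by rewrite (leq_trans (max_card _)).
by rewrite /= lt_eqF // xy.
Qed.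

Lemma mobius_nle (x y : T) : ~~ (x <= y)%O -> mobius x y = 0.
Proof.
move=> nxy; rewrite /mobius; case: #|T| => //= n.
case: eqP nxy => [->|_]; first by rewrite lexx.
by rewrite le_eqVlt negb_or => /andP[_ /negbTE ->].
Qed.

End Mobius.

Definition mu {disp : Order.disp_t} (P : finTBPOrderType disp) : int :=
  mobius (\bot%O : P) (\top%O : P).

Definition with_bot (T : Type) : Type := option T.

Section WithBot.

Context {disp : Order.disp_t}.

HB.instance Definition _ (T : finPOrderType disp) :=
  Finite.copy (with_bot T) (option T).

Definition with_bot_le (T : finPOrderType disp) (u v : with_bot T) : bool :=
  match u, v with
  | None, _ => true
  | Some _, None => false
  | Some x, Some y => (x <= y)%O
  end.

Fact with_bot_le_refl (T : finPOrderType disp) : reflexive (@with_bot_le T).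
Proof. by case=> /=. Qed.

Fact with_bot_le_anti (T : finPOrderType disp) :
  antisymmetric (@with_bot_le T).
Proof. by move=> [x|] [y|] //= /le_anti ->. Qed.

Fact with_bot_le_trans (T : finPOrderType disp) : transitive (@with_bot_le T).
Proof. by move=> [y|] [x|] [z|] //=; exact: le_trans. Qed.

HB.instance Definition _ (T : finPOrderType disp) :=
  Order.Le_isPOrder.Build disp (with_bot T) (@with_bot_le_refl T)
    (@with_bot_le_anti T) (@with_bot_le_trans T).

Fact with_bot_le0x (T : finPOrderType disp) (u : with_bot T) :
  ((None : with_bot T) <= u)%O.
Proof. by []. Qed.

HB.instance Definition _ (T : finPOrderType disp) :=
  Order.hasBottom.Build disp (with_bot T) (@with_bot_le0x T).

Fact with_bot_lex1 (T : finTBPOrderType disp) (u : with_bot T) :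
  (u <= (Some \top%O : with_bot T))%O.
Proof. by case: u => //= x; exact: lex1. Qed.

HB.instance Definition _ (T : finTBPOrderType disp) :=
  Order.hasTop.Build disp (with_bot T) (@with_bot_lex1 T).

End WithBot.

Fact dowling_display : Order.disp_t.
Proof. exact: Order.Disp tt tt. Qed.

Section Dowling.

Variables N s : nat.

(* The group Z/sZ, for s > 0: unlike 'Z_s, the type 'I_s.-1.+1 is also right  *)
(* for s = 1. It is written additively.                                       *)
Notation label := 'I_s.-1.+1.

(* A triple (I, pi, lambda); the map lambda on the complement of I is         *)
(* extended by 0 on I.                                                        *)
Definition is_prepart
    (x : {set 'I_N} * {set {set 'I_N}} * {ffun 'I_N -> label}) : bool :=
  partition x.1.2 (~: x.1.1) && [forall i in x.1.1, x.2 i == 0].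

Record prepart : Type :=
  Prepart { prepart_val :> {set 'I_N} * {set {set 'I_N}} * {ffun 'I_N -> label};
            _ : is_prepart prepart_val }.

HB.instance Definition _ := [isSub for prepart_val].
HB.instance Definition _ := [Finite of prepart by <:].

Definition zero_block (x : prepart) : {set 'I_N} := (val x).1.1.
Definition blocks (x : prepart) : {set {set 'I_N}} := (val x).1.2.
Definition lab (x : prepart) : {ffun 'I_N -> label} := (val x).2.

Definition prepart_eqv (x y : prepart) : bool :=
  [&& zero_block x == zero_block y, blocks x == blocks y
    & [forall B in blocks x,
        [exists g : label, [forall i in B, lab y i == lab x i + g]]]].

Fact prepart_eqv_refl : reflexive prepart_eqv.
Proof.
move=> x; rewrite /prepart_eqv !eqxx /=; apply/forall_inP => B _.
by apply/existsP; exists 0; apply/forall_inP => i _; rewrite addr0.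
Qed.

Fact prepart_eqv_sym : symmetric prepart_eqv.
Proof.
suff imp x y : prepart_eqv x y -> prepart_eqv y x by move=> x y; apply/idP/idP; exact: imp.
case/and3P=> /eqP zE /eqP bE /forall_inP H; rewrite /prepart_eqv zE bE !eqxx /=.
apply/forall_inP => B; rewrite -bE => /H/existsP[g /forall_inP Hg].
apply/existsP; exists (- g); apply/forall_inP => i /Hg/eqP ->.
by rewrite addrK.
Qed.

Fact prepart_eqv_trans : transitive prepart_eqv.
Proof.
move=> y x z /and3P[/eqP zE /eqP bE /forall_inP H].
case/and3P=> /eqP zE' /eqP bE' /forall_inP H'.
rewrite /prepart_eqv zE bE zE' bE' !eqxx /=.
apply/forall_inP => B; rewrite -bE' -bE => HB; have HB' := HB.
move: HB => /H/existsP[g /forall_inP Hg].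
move: HB'; rewrite bE => /H'/existsP[h /forall_inP Hh].
apply/existsP; exists (g + h); apply/forall_inP => i iB.
by rewrite (eqP (Hh i iB)) (eqP (Hg i iB)) addrA.
Qed.

Canonical prepart_equiv :=
  EquivRel prepart_eqv prepart_eqv_refl prepart_eqv_sym prepart_eqv_trans.

Definition dowling : Type := {eq_quot prepart_equiv}.

HB.instance Definition _ := Quotient.on dowling.
HB.instance Definition _ := [Finite of dowling by <:%/].

Definition merge_zero (x y : prepart) : bool :=
  [exists B in blocks x,
    [&& zero_block y == B :|: zero_block x, blocks y == blocks x :\ B
      & [forall i in ~: zero_block y, lab y i == lab x i]]].

Definition merge_two (x y : prepart) : bool :=
  [exists B in blocks x, exists C in blocks x, exists g : label,
    [&& B != C, zero_block y == zero_block x,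
        blocks y == (B :|: C) |: (blocks x :\ B :\ C)
      & [forall i, lab y i == if i \in C then lab x i + g else lab x i]]].

Definition dowling_cov (a b : dowling) : bool :=
  [exists x : prepart, exists y : prepart,
    [&& \pi_dowling x == a, \pi_dowling y == b
      & merge_zero x y || merge_two x y]].

Definition dowling_le : rel dowling := connect dowling_cov.

Lemma dowling_piP (x y : prepart) :
  reflect (\pi_dowling x = \pi_dowling y) (prepart_eqv x y).
Proof. exact: eqmodP. Qed.

Lemma blocks_repr (x : prepart) : blocks (repr (\pi_dowling x)) = blocks x.
Proof.
have /dowling_piP/and3P[_ /eqP -> //] : \pi_dowling (repr (\pi_dowling x)) = \pi_dowling x.
exact: reprK.
Qed.

Lemma merge_card (x y : prepart) :
  merge_zero x y || merge_two x y -> (#|blocks y| < #|blocks x|)%N.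
Proof.
case/orP=> [/exists_inP[B HB /and3P[_ /eqP -> _]]|].
  by rewrite (cardsD1 B (blocks x)) HB.
case/exists_inP=> B HB /exists_inP[C HC] /existsP[g] /and4P[BC _ /eqP -> _].
rewrite (cardsD1 B (blocks x)) HB (cardsD1 C (blocks x :\ B)) !inE HC.
rewrite eq_sym BC /= cardsU1; by case: (_ \notin _).
Qed.

Lemma dowling_cov_card (a b : dowling) :
  dowling_cov a b -> (#|blocks (repr b)| < #|blocks (repr a)|)%N.
Proof.
case/existsP=> x /existsP[y] /and3P[/eqP <- /eqP <- /merge_card].
by rewrite !blocks_repr.
Qed.

Lemma dowling_le_card (a b : dowling) :
  dowling_le a b -> a = b \/ (#|blocks (repr b)| < #|blocks (repr a)|)%N.
Proof.
case/connectP=> p; elim: p a => [|c p IH] a /=; first by left.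
case/andP=> /dowling_cov_card ac /IH{}IH /IH [<-|cb]; right => //.
exact: ltn_trans ac.
Qed.

Fact dowling_le_refl : reflexive dowling_le.
Proof. exact: connect0. Qed.

Fact dowling_le_anti : antisymmetric dowling_le.
Proof.
move=> a b /andP[/dowling_le_card[//|ab] /dowling_le_card[//|ba]].
by have := ltn_trans ab ba; rewrite ltnn.
Qed.

Fact dowling_le_trans : transitive dowling_le.
Proof. exact: connect_trans. Qed.

HB.instance Definition _ :=
  Order.Le_isPOrder.Build dowling_display dowling
    dowling_le_refl dowling_le_anti dowling_le_trans.

Lemma merge_le (x y : prepart) :
  merge_zero x y || merge_two x y ->
  (\pi_dowling x <= \pi_dowling y :> dowling)%O.
Proof.
move=> H; apply: connect1; apply/existsP; exists x; apply/existsP; exists y.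
by rewrite !eqxx.
Qed.

Lemma prepart_partition (x : prepart) : partition (blocks x) (~: zero_block x).
Proof. by have /andP[] := valP x. Qed.

Lemma lab_zero (x : prepart) i : i \in zero_block x -> lab x i = 0.
Proof. by have /andP[_ /forall_inP H] := valP x => /H/eqP. Qed.

Definition singletons : {set {set 'I_N}} := [set [set i] | i : 'I_N].

Fact dowling_bot_subproof : is_prepart (set0, singletons, [ffun=> 0]).
Proof.
apply/andP; split=> /=; last by apply/forall_inP => i; rewrite inE.
rewrite setC0; apply/and3P; split.
- apply/eqP/setP => i; rewrite inE; apply/bigcupP; exists [set i]; rewrite ?inE //.
  exact: imset_f.
- apply/trivIsetP => _ _ /imsetP[i _ ->] /imsetP[j _ ->] ij.
  by rewrite disjoints1 inE; apply: contraNneq ij => ->.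
- by apply/imsetP => -[i _ /setP/(_ i)]; rewrite !inE eqxx.
Qed.

Definition dowling_bot : dowling := \pi_dowling (Prepart dowling_bot_subproof).

Fact dowling_top_subproof : is_prepart ([set: 'I_N], set0, [ffun=> 0]).
Proof.
rewrite /is_prepart /= setCT partition_set0 eqxx /=.
by apply/forall_inP => i _; rewrite ffunE.
Qed.

Definition dowling_top : dowling := \pi_dowling (Prepart dowling_top_subproof).

Fact dowling_le0x (a : dowling) : (dowling_bot <= a)%O.
Proof.
rewrite -[a]reprK ?/dowling_bot ?/dowling_top; set x := repr a; move: x => {a} x.
have [n] := ubnP (#|{set 'I_N}| - #|blocks x|)%N.
elim: n x => // n IH x /[!ltnS] hn.
suff [[y /orP H]|/dowling_piP ->] : (exists y, merge_zero y x \/ merge_two y x) \/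
    prepart_eqv (Prepart dowling_bot_subproof) x.
- apply: le_trans (merge_le H); apply: IH; apply: leq_trans hn.
  by apply: ltn_sub2l (merge_card H); apply: leq_trans (merge_card H) (max_card _).
- exact: lexx.
have Px := prepart_partition x.
have [I0|[i iI]] := set_0Vmem (zero_block x); last first.
- left; have Py : is_prepart (zero_block x :\ i, [set i] |: blocks x, lab x).
    apply/andP; split=> /=.
      have -> : ~: (zero_block x :\ i) = [set i] :|: ~: zero_block x.
        by apply/setP => j; rewrite !inE negb_and negbK.
      apply: partitionU1 Px _ _; first by apply/set0Pn; exists i; rewrite inE.
      by rewrite disjoints1 inE iI.
    by apply/forall_inP => j /setD1P[_ /lab_zero ->].
  exists (Prepart Py); left; apply/exists_inP; exists [set i].
    by rewrite !inE eqxx.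
  rewrite {1 2}/zero_block {1}/blocks /= setD1K // eqxx /=.
  apply/andP; split; last by apply/forall_inP.
  rewrite eq_sym setU1K //; apply/negP => /(partitionS Px).
  by rewrite sub1set inE iI.
- rewrite I0 setC0 in Px.
  have [/existsP[B /andP[HB B1]]|nB] := boolP [exists B in blocks x, 1 < #|B|]%N.
    left; have [i iB] : exists i, i \in B by apply/card_gt0P; exact: ltnW.
    have BD0 : B :\ i != set0.
      by rewrite -card_gt0; move: B1; rewrite (cardsD1 i B) iB.
    have P1 := partitionD1 Px HB.
    have P2 : partition ((B :\ i) |: (blocks x :\ B)) ((B :\ i) :|: ([set: 'I_N] :\: B)).
      apply: partitionU1 P1 BD0 _; rewrite -setI_eq0; apply/eqP/setP => j.
      by rewrite !inE; case: (j \in B); rewrite ?andbF.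
    have P3 : partition ([set i] |: ((B :\ i) |: (blocks x :\ B))) setT.
      have -> : [set: 'I_N] = [set i] :|: ((B :\ i) :|: ([set: 'I_N] :\: B)).
        by apply/setP => j; rewrite !inE; case: eqP => //= _; case: (j \in B).
      apply: partitionU1 P2 _ _; first by apply/set0Pn; exists i; rewrite inE.
      by rewrite disjoints1 !inE eqxx iB.
    have Py : is_prepart (set0, [set i] |: ((B :\ i) |: (blocks x :\ B)), lab x).
      by rewrite /is_prepart /= setC0 P3 /=; apply/forall_inP => j; rewrite inE.
    have BiN : B :\ i \notin blocks x :\ B.
      apply/negP => H; have /set0Pn[j jB] := BD0.
      by have /subsetP/(_ _ jB) := partitionS P1 H; move: jB; rewrite !inE => /andP[_ ->].
    have iN : [set i] \notin (B :\ i) |: (blocks x :\ B).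
      apply/negP => /(partitionS P2); rewrite sub1set !inE eqxx iB /=; by [].
    exists (Prepart Py); right; apply/exists_inP; exists [set i].
      by rewrite !inE eqxx.
    apply/exists_inP; exists (B :\ i); first by rewrite !inE eqxx orbT.
    apply/existsP; exists 0; apply/and4P; split.
    + by apply: contraNneq iN => {1}->; rewrite setU11.
    + by rewrite I0.
    + by rewrite {2}/blocks /= (setU1K iN) (setU1K BiN) (setD1K iB) setD1K.
    + by apply/forallP => j; rewrite {2 3}/lab /= addr0 if_same.
  right; rewrite /prepart_eqv I0 eqxx /=.
  have bE : blocks x = singletons.
    apply/setP => B; apply/idP/imsetP => [HB|[i _ ->]].
      have : #|B| == 1.
        rewrite eqn_leq card_gt0 (partition_neq0 Px HB) andbT leqNgt.
        by apply: contra nB => B1; apply/exists_inP; exists B.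
      by case/cards1P=> i ->; exists i.
    have: i \in cover (blocks x) by rewrite (cover_partition Px) inE.
    case/bigcupP=> C HC iC.
    suff -> : [set i] = C by [].
    apply/eqP; rewrite eqEcard sub1set iC cards1 leqNgt.
    by apply: contra nB => B1; apply/exists_inP; exists C.
  rewrite bE eqxx /=; apply/forall_inP => _ /imsetP[i _ ->].
  apply/existsP; exists (lab x i); apply/forall_inP => j; rewrite inE => /eqP ->.
  by rewrite {2}/lab /= ffunE add0r.
Qed.

Fact dowling_lex1 (a : dowling) : (a <= dowling_top)%O.
Proof.
rewrite -[a]reprK ?/dowling_bot ?/dowling_top; set x := repr a; move: x => {a} x.
have [n] := ubnP #|blocks x|; elim: n x => // n IH x /[!ltnS] hn.
have Px := prepart_partition x.
have [b0|[B HB]] := set_0Vmem (blocks x).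
  suff /dowling_piP -> : prepart_eqv x (Prepart dowling_top_subproof) by exact: lexx.
  rewrite /prepart_eqv b0 eqxx /=; apply/andP; split.
    rewrite -(setCK (zero_block x)) -(cover_partition Px) b0 /cover big_set0.
    by rewrite setC0.
  by apply/forall_inP => B; rewrite inE.
have Py : is_prepart (B :|: zero_block x, blocks x :\ B,
    [ffun i => if i \in B :|: zero_block x then 0 else lab x i]).
  apply/andP; split=> /=.
    have -> : ~: (B :|: zero_block x) = ~: zero_block x :\: B.
      by apply/setP => j; rewrite !inE negb_or.
    exact: partitionD1.
  by apply/forall_inP => i iI; rewrite ffunE iI.
have H : merge_zero x (Prepart Py) || merge_two x (Prepart Py).
  apply/orP; left; apply/exists_inP; exists B => //.
  rewrite /zero_block /= {1}/blocks /= !eqxx /=.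
  by apply/forall_inP => i; rewrite inE /lab /= ffunE => /negbTE ->.
apply: le_trans (merge_le H) _; apply: IH.
exact: leq_trans (merge_card H) hn.
Qed.

HB.instance Definition _ :=
  Order.hasBottom.Build dowling_display dowling dowling_le0x.
HB.instance Definition _ :=
  Order.hasTop.Build dowling_display dowling dowling_lex1.

Definition balanced (d k : nat) (x : prepart) : bool :=
  [forall B in blocks x,
    (d %| #|B|)%N &&
    [forall j1 : 'I_k, forall j2 : 'I_k,
      #|[set a in B | (lab x a %% k == j1)%N]|
      == #|[set a in B | (lab x a %% k == j2)%N]|]].

Lemma balanced_eqv (d k : nat) (x y : prepart) : (0 < s)%N -> (k %| s)%N ->
  prepart_eqv x y -> balanced d k x = balanced d k y.
Proof.
move=> s0 ks.
suff imp u v : prepart_eqv u v -> balanced d k u -> balanced d k v.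
  by move=> xy; apply/idP/idP; apply: imp; rewrite // prepart_eqv_sym.
case/and3P=> _ /eqP bE /forall_inP H /forall_inP bal; apply/forall_inP => B.
rewrite -bE => HB; have /andP[-> /= /forallP cst] := bal B HB.
have /existsP[g /forall_inP Hg] := H B HB.
have k0 : (0 < k)%N := dvdn_gt0 s0 ks.
pose sh (j : 'I_k) := Ordinal (ltn_pmod (j + (k - g %% k)) k0).
have cntE (j : 'I_k) :
    [set a in B | (lab v a %% k == j)%N] = [set a in B | (lab u a %% k == sh j)%N].
  apply/setP => a; rewrite !inE; case aB: (a \in B) => //=.
  rewrite (eqP (Hg a aB)) /= [in LHS]modn_dvdm; last by rewrite prednK.
  rewrite -[in LHS](modn_small (ltn_ord j)) -(eqn_modDr (k - g %% k)).
  have E : ((g + (k - g %% k)) %% k = 0)%N.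
    by rewrite -modnDml subnKC ?modnn // ltnW // ltn_pmod.
  by rewrite -addnA -[in LHS]modnDmr E addn0.
apply/forallP => j1; apply/forallP => j2; rewrite !cntE.
by have /forallP := cst (sh j1); apply.
Qed.

(* Q_N(s, d, k), with the order induced by Q_N(s). Choosing the               *)
(* representative repr is harmless when k divides s, by balanced_eqv.         *)
Record dowling_sub (d k : nat) : Type := DowlingSub {
  dowling_sub_val :> dowling;
  _ : (dowling_sub_val == \bot%O) || balanced d k (repr dowling_sub_val) }.

Section Sub.

Variables d k : nat.

HB.instance Definition _ := [isSub for @dowling_sub_val d k].
HB.instance Definition _ := [Finite of dowling_sub d k by <:].
HB.instance Definition _ :=
  [SubChoice_isSubPOrder of dowling_sub d k by <: with dowling_display].

Fact dowling_sub_bot_subproof :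
  ((\bot%O : dowling) == \bot%O) || balanced d k (repr (\bot%O : dowling)).
Proof. by rewrite eqxx. Qed.

Fact dowling_sub_top_subproof :
  ((\top%O : dowling) == \bot%O) || balanced d k (repr (\top%O : dowling)).
Proof.
by apply/orP; right; apply/forall_inP => B; rewrite blocks_repr inE.
Qed.

Fact dowling_sub_le0x (a : dowling_sub d k) :
  (DowlingSub dowling_sub_bot_subproof <= a)%O.
Proof. exact: (le0x (val a)). Qed.

Fact dowling_sub_lex1 (a : dowling_sub d k) :
  (a <= DowlingSub dowling_sub_top_subproof)%O.
Proof. exact: (lex1 (val a)). Qed.

HB.instance Definition _ := Order.hasBottom.Build dowling_display
  (dowling_sub d k) dowling_sub_le0x.
HB.instance Definition _ := Order.hasTop.Build dowling_display
  (dowling_sub d k) dowling_sub_lex1.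

End Sub.

End Dowling.

(* The number mu(Q_N(s, d, k)), with a new minimum adjoined when the minimum  *)
(* of Q_N(s) itself satisfies the condition on nonzero blocks: for N = 0,     *)
(* which gives the two-element chain, and for d = 1. In the other cases the   *)
(* minimum of Q_N(s) is already not one of the elements satisfying the        *)
(* condition. For d = 1 the new minimum is needed in generating function      *)
(* identities: the plain Dowling lattice Q_1(r) has mu = -1, against a        *)
(* coefficient 0 in the series - exp(x) * exp(r x) ^ (- 1 / r) = -1.          *)
Definition mu_dowling_sub (N s d k : nat) : int :=
  if (N == 0)%N || (d == 1)%N then mu (with_bot (dowling_sub N s d k))
  else mu (dowling_sub N s d k).

Definition fps : Type := nat -> rat.

Definition fps_mul (F G : fps) : fps :=
  fun n => \sum_(i < n.+1) F i * G (n - i)%N.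

Definition fps_one : fps := fun n => (n == 0)%:R.

Definition fps_exp (F : fps) (k : nat) : fps := iter k (fps_mul F) fps_one.

Definition gbinom (a : rat) (k : nat) : rat :=
  (\prod_(i < k) (a - i%:R)) / k`!%:R.

(* F ^ a by the binomial series \sum_k (a choose k) (F - 1) ^ k, for a series *)
(* F with constant term 1: then (F - 1) ^ k has no term of degree < k, so the *)
(* terms k > n do not contribute to the coefficient of degree n.              *)
Definition fps_pow (F : fps) (a : rat) : fps :=
  fun n => \sum_(k < n.+1) gbinom a k * fps_exp (fun m => F m - fps_one m) k n.

(* Main.v *)
Require Import Defs.
From mathcomp Require Import all_boot all_order all_algebra.
From mathcomp Require Import ring zify.

Set Implicit Arguments.
Unset Strict Implicit.
Unset Printing Implicit Defensive.

Import Order.TTheory GRing.Theory Num.Theory.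

Local Open Scope ring_scope.
Local Open Scope quotient_scope.

(* Put s = d r and colour [N] by maps h : [N] -> {0} + [m] x Z/sZ. Each h     *)
(* induces an element of Q_N(s), which lies above v exactly when h, corrected *)
(* by the labels of v, is constant on the blocks of v and 0 on the zero       *)
(* block; so (1 + s m)^l colourings induce an element above v, where l is the *)
(* number of nonzero blocks of v. By triangularity the number of h inducing z *)
(* is p_z(m) for a polynomial p_z, and at m = - 1 / s the sum of p_z over     *)
(* z >= v is the indicator of v = 1. As balanced elements form an upper set,  *)
(* mu = - \sum p_z(- 1 / s) over the balanced z. On the other hand            *)
(* \sum p_z(m) over the balanced z counts balanced colourings, which          *)
(* multinomial coefficients identify with the coefficient of w c^m. Both      *)
(* sides are polynomials in m, hence they agree at m = - 1 / s.               *)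

(** * Summation over upper sets *)

(** The exponent - 1 / (d r) is reached by interpolation: there is no colouring with - 1 / s block
    names, but in each degree both sides are polynomials in the number m of names, and
    [poly_nat_inj] extends an identity at all natural m to every argument. The lattice side rests on
    [card_compat]: the number of colourings above an element depends only on its number of nonzero
    blocks. Inversion over upper sets ([upper_sum_solvable], [upper_sum_inj]) then yields the
    polynomials of [dowling_colouring_poly], and [mu_dowling_sub_sum] reads the Möbius number off
    their values at - 1 / s. The counting side is [balanced_colouring_series], which meets [fps_pow]
    through [fps_pow_nat] and [fps_pow_poly]. *)

Section UpperSums.

Variables (disp : Order.disp_t) (T : finPOrderType disp).

Lemma mobius_sum (x y : T) : (x <= y)%O ->
  \sum_(z : T | (x <= z <= y)%O) mobius x z = (x == y)%:R.
Proof.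
move=> xy; rewrite (bigD1 y) ?xy ?lexx //=.
rewrite (eq_bigl (fun z => x <= z < y)%O); last first.
  by move=> z; rewrite lt_neqAle -andbA [(_ <= y)%O && _]andbC.
have [<-|nxy] := eqVneq x y.
  rewrite mobius_id big1 ?addr0 // => z /andP[xz zx].
  by have := le_lt_trans xz zx; rewrite ltxx.
by rewrite mobius_lt ?addNr // lt_neqAle nxy.
Qed.

(** Uniqueness half of Möbius inversion, by induction on the size of the upper set of [v]: the terms
    strictly above [v] already agree, so they cancel. *)
Lemma upper_sum_inj (V : zmodType) (p q : T -> V) :
  (forall v, \sum_(z : T | (v <= z)%O) p z = \sum_(z : T | (v <= z)%O) q z) ->
  p =1 q.
Proof.
move=> pq v; have [n] := ubnP #|[set z | (v <= z)%O]|.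
elim: n v => // n IH v /[!ltnS] hn.
have := pq v; rewrite (bigD1 v) //= [RHS](bigD1 v) //=.
rewrite [X in _ + X = _](eq_bigr q); first by move/addIr.
move=> z /andP[vz zv]; apply: IH; apply: leq_trans hn.
apply: proper_card; apply/properP; split.
  by apply/subsetP => t; rewrite !inE; exact: le_trans.
exists v; rewrite !inE ?lexx //; apply/negP => zv'.
by case/eqP: zv; apply/le_anti; rewrite zv'.
Qed.

End UpperSums.

(** Existence half of Möbius inversion. Upper sets of [T] are lower sets of the dual, so the Möbius
    function of [T^d] provides the inverse. *)
Lemma upper_sum_solvable (disp : Order.disp_t) (T : finPOrderType disp)
    (V : zmodType) (g : T -> V) :
  exists p : T -> V, forall v, \sum_(z : T | (v <= z)%O) p z = g v.
Proof.
exists (fun z => \sum_(w : T | (z <= w)%O) g w *~ mobius (w : T^d) (z : T^d)).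
move=> v; rewrite (exchange_big_dep (fun w => v <= w)%O) /=; last first.
  by move=> z w; exact: le_trans.
have sumE (w : T) : (v <= w)%O ->
    \sum_(z : T | (v <= z)%O && (z <= w)%O) g w *~ mobius (w : T^d) (z : T^d)
    = if w == v then g v else 0.
  move=> vw; have := @mobius_sum _ (T^d) (w : T^d) (v : T^d) vw.
  rewrite -mulrz_sumr (eq_bigl (fun z : T => v <= z <= w)%O) => [->|z]; last by rewrite andbC.
  by case: eqP => [->|].
rewrite (eq_bigr _ sumE) -big_mkcondr /= (eq_bigl (pred1 v)) ?big_pred1_eq //.
by move=> w /=; case: eqP => [->|]; rewrite ?lexx ?andbF.
Qed.

(* Pairing [f] with [mobius \bot] and exchanging the two summations. *)
Lemma mu_upper_sum (R : pzRingType) (disp : Order.disp_t) (P : finTBPOrderType disp)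
    (f : P -> R) :
  (\bot%O : P) != \top%O ->
  (forall w : P, w != \bot%O -> \sum_(z : P | (w <= z)%O) f z = (w == \top%O)%:R) ->
  (mu P)%:~R = - \sum_(z : P | z != \bot%O) f z.
Proof.
(* The value of [g] at the bottom makes its total sum vanish, so the upper sums of [g] are the
   indicator of the top at every element. *)
move=> bt hf; pose g z := if z == \bot%O then - \sum_(z | z != \bot%O) f z else f z.
have hg w : \sum_(z : P | (w <= z)%O) g z = (w == \top%O)%:R.
  have [->|wb] := eqVneq w \bot%O; last first.
    rewrite -hf //; apply: eq_bigr => z wz; rewrite /g; case: eqP => // zb.
    by case/eqP: wb; apply/le_anti; rewrite -{1}zb wz le0x.
  rewrite (negbTE bt) (eq_bigl xpredT) => [|z]; last exact: le0x.
  rewrite (bigD1 \bot%O) //= {1}/g eqxx; apply/eqP; rewrite addrC subr_eq0.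
  by apply/eqP/eq_bigr => z /negbTE; rewrite /g => ->.
transitivity (\sum_(w : P) \sum_(z : P | (w <= z)%O) (mobius \bot%O w)%:~R * g z).
  rewrite (bigD1 \top%O) //= -mulr_sumr hg eqxx mulr1 big1 ?addr0 // => w wt.
  by rewrite -mulr_sumr hg (negbTE wt) mulr0.
rewrite (exchange_big_dep xpredT) //= (bigD1 \bot%O) //= -mulr_suml.
rewrite [X in _ + X]big1 ?addr0 => [|z zb].
  rewrite (eq_bigl (pred1 (\bot%O : P))); first by rewrite big_pred1_eq mobius_id mul1r /g eqxx.
  by move=> z /=; rewrite lex0.
rewrite -mulr_suml -(rmorph_sum (intr : int -> R)) /=.
rewrite (eq_bigl (fun w => \bot <= w <= z)%O) => [|w]; last by rewrite le0x.
by rewrite mobius_sum ?le0x // eq_sym (negbTE zb) mul0r.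
Qed.

Lemma poly_nat_inj (R : numDomainType) (p q : {poly R}) :
  (forall m : nat, p.[m%:R] = q.[m%:R]) -> p = q.
Proof.
move=> pq; apply/eqP; rewrite -subr_eq0; apply/eqP.
apply: (roots_geq_poly_eq0 (rs := [seq (m%:R : R) | m <- iota 0 (size (p - q))])).
- by apply/allP => _ /mapP[m _ ->]; rewrite /root !hornerE pq subrr.
- by rewrite map_inj_uniq ?iota_uniq // => m n /eqP; rewrite eqr_nat => /eqP.
- by rewrite size_map size_iota.
Qed.

(** * Powers of formal power series *)

(** Coefficients up to degree n only see the truncation at degree n, so powers of series can be
    computed in the ring of polynomials. *)
Lemma coef_exp_fps (P : {poly rat}) (F : fps) (n k : nat) :
  (forall j, (j <= n)%N -> P`_j = F j) ->
  forall j, (j <= n)%N -> (P ^+ k)`_j = fps_exp F k j.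
Proof.
move=> PF; elim: k => [|k IH] j jn; first by rewrite expr0 coef1.
rewrite exprS coefM; apply: eq_bigr => i _.
by rewrite PF ?IH // ?(leq_trans (leq_subr _ _)) // (leq_trans _ jn) // -ltnS.
Qed.

Lemma fps_exp_sum (F : fps) (m n j : nat) : (j <= n)%N ->
  fps_exp F m j = \sum_(f : {ffun 'I_m -> 'I_n.+1} | (\sum_i f i == j)%N)
                    \prod_i F (f i).
Proof.
move=> jn; rewrite -(@coef_exp_fps (\poly_(i < n.+1) F i) F n) // => [|i ni]; last first.
  by rewrite coef_poly ltnS ni.
have -> : (\poly_(i < n.+1) F i) ^+ m =
    \sum_(f : {ffun 'I_m -> 'I_n.+1}) \prod_i (F (f i) *: 'X^(f i)).
  by rewrite -(bigA_distr_bigA (fun (_ : 'I_m) (k : 'I_n.+1) => F k *: 'X^k)) -poly_def prodr_const card_ord.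
rewrite coef_sum [RHS]big_mkcond; apply: eq_bigr => f _.
rewrite scaler_prod coefZ -expr_sum coefXn eq_sym.
by case: eqP; rewrite ?mulr1 ?mulr0.
Qed.

Lemma gbinom_nat (m k : nat) : gbinom m%:R k = 'C(m, k)%:R.
Proof.
apply: canLR (mulfK _) _; first by rewrite pnatr_eq0 -lt0n fact_gt0.
rewrite -natrM bin_ffact; elim: k => [|k IH]; first by rewrite big_ord0.
rewrite big_ord_recr IH ffactnSr /= natrM.
have [km|mk] := leqP k m; first by rewrite natrB.
by rewrite ffact_small // !mul0r.
Qed.

Lemma fps_pow_nat (F : fps) (m n : nat) : F 0%N = 1 ->
  fps_pow F m%:R n = fps_exp F m n.
Proof.
move=> F0; pose P : {poly rat} := \poly_(i < n.+1) F i.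
pose D := \poly_(i < n) F i.+1.
have PE : P = D * 'X + 1.
  apply/polyP => i; rewrite coefD coefMX !coef_poly coef1 ltnS.
  case: i => [|i] /=; first by rewrite F0 add0r.
  by rewrite addr0.
have Pn j : (j <= n)%N -> P`_j = F j by rewrite coef_poly ltnS => ->.
have Dn j : (j <= n)%N -> (D * 'X)`_j = F j - fps_one j.
  move=> jn; apply/eqP; rewrite -(inj_eq (addIr ((1 : {poly rat})`_j))) -coefD -PE Pn //.
  by rewrite coef1 subrK.
rewrite -(coef_exp_fps _ Pn) // PE exprD1n coef_sum.
(* A common range for both sums: terms with k > n vanish because 'X^k divides them, terms with k > m
   because 'C(m, k) = 0. *)
transitivity (\sum_(k < (m + n).+1) 'C(m, k)%:R * ((D * 'X) ^+ k)`_n).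
  rewrite /fps_pow (big_ord_widen (m + n).+1 (fun k => gbinom m%:R k *
    fps_exp (fun m0 => F m0 - fps_one m0) k n)) ?ltnS ?leq_addl // big_mkcond.
  apply: eq_bigr => k _; rewrite gbinom_nat -(coef_exp_fps _ Dn) // ltnS.
  by case: leqP => // nk; rewrite exprMn coefMXn nk mulr0.
rewrite [RHS](big_ord_widen (m + n).+1 (fun k => ((D * 'X) ^+ k *+ 'C(m, k))`_n)) ?ltnS ?leq_addr //.
rewrite [RHS]big_mkcond; apply: eq_bigr => k _; rewrite coefMn mulr_natl ltnS.
by case: leqP => // mk; rewrite bin_small // mulr0n.
Qed.

(** For a fixed degree the binomial series is a finite sum, and each generalized binomial
    coefficient is a polynomial in the exponent. *)
Lemma fps_pow_poly (F : fps) :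
  exists p : nat -> {poly rat}, forall n a, (p n).[a] = fps_pow F a n.
Proof.
exists (fun n => \sum_(k < n.+1) (fps_exp (fun m => F m - fps_one m) k n / k`!%:R) *:
  \prod_(i < k) ('X - i%:R%:P)) => n a.
rewrite horner_sum; apply: eq_bigr => k _; rewrite hornerZ horner_prod /gbinom.
rewrite (eq_bigr (fun i : 'I_k => a - i%:R)) => [|i _]; last by rewrite hornerXsubC.
by rewrite mulrC mulrA mulrAC.
Qed.

(** * Functions with prescribed fibre sizes *)

(** A multinomial coefficient chooses the positions of each class, then every position picks an
    element of its class; the factorials are multiplied across to avoid division. The induction
    removes the head of the tuple. *)
Lemma card_tuple_profile (K K' : finType) (u : K -> K') (n : nat) (m : K' -> nat) :
  (\sum_c m c = n)%N ->
  (#|[set t : n.-tuple K | [forall c, count (fun y => u y == c) t == m c]]|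
     * \prod_c (m c)`! = n`! * \prod_c #|[set y | u y == c]| ^ m c)%N.
Proof.
elim: n m => [|n IH] m sm.
  have m0 c : m c = 0%N by move/eqP: sm; rewrite sum_nat_eq0 => /forallP/(_ c)/eqP.
  rewrite !big1 // => [|c _|c _]; rewrite ?m0 ?expn0 // muln1.
  rewrite (_ : [set t | _] = setT) ?cardsT ?card_tuple ?expn0 //.
  by apply/setP => t; rewrite !inE tuple0; apply/forallP => c; rewrite m0.
pose m' c0 c := (m c - (c == c0))%N.
have splitE : (#|[set t : n.+1.-tuple K | [forall c, count (fun y => u y == c) t == m c]]|
    = \sum_y if 0 < m (u y) then
        #|[set t : n.-tuple K | [forall c, count (fun y => u y == c) t == m' (u y) c]]|
      else 0)%N.
  rewrite -sum1_card (reindex (fun p : K * n.-tuple K => cons_tuple p.1 p.2)) /=; last first.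
    exists (fun t => (thead t, behead_tuple t)) => [[y t] _|t _] /=.
      by rewrite theadE; congr (_, _); apply/val_inj.
    by apply/val_inj; rewrite /= [in RHS](tuple_eta t).
  rewrite -(pair_big_dep xpredT (fun y (t : n.-tuple K) => cons_tuple y t \in
    [set t : n.+1.-tuple K | [forall c, count (fun y => u y == c) t == m c]])
    (fun _ _ => 1%N)) /=.
  apply: eq_bigr => y _; case: (posnP (m (u y))) => [m0|mp].
    rewrite big1 // => t; rewrite inE => /forallP/(_ (u y)) /=.
    by rewrite eqxx m0.
  rewrite -sum1_card; apply: eq_bigl => t; rewrite !inE; apply: eq_forallb => c /=.
  rewrite /m' (eq_sym c); have [<-|_] := eqVneq (u y) c; last by rewrite subn0.
  by case: (m (u y)) mp => // k _; rewrite add1n subn1 eqSS.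
(* Heads in the class [c0] account for the share [m c0] of the common product; these shares add up
   to n + 1, which turns n! into (n + 1)!. *)
have termE c0 : (0 < m c0)%N ->
    (#|[set t : n.-tuple K | [forall c, count (fun y => u y == c) t == m' c0 c]]|
      * \prod_c (m c)`! * #|[set y | u y == c0]|
    = m c0 * (n`! * \prod_c #|[set y | u y == c]| ^ m c))%N.
  move=> mp.
  have m'E c : c != c0 -> m' c0 c = m c by rewrite /m' => /negbTE ->; rewrite subn0.
  have m'c0 : (m' c0 c0).+1 = m c0 by rewrite /m' eqxx subn1 prednK.
  have sm' : (\sum_c m' c0 c = n)%N.
    apply: succn_inj; rewrite -sm (bigD1 c0) //= [RHS](bigD1 c0) //= -m'c0 addSn.
    by rewrite (eq_bigr m).
  have prodE (F : K' -> nat -> nat) :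
      (\prod_c F c (m' c0 c) = F c0 (m' c0 c0) * \prod_(c | c != c0) F c (m c))%N.
    by rewrite (bigD1 c0) //=; congr (_ * _)%N; apply: eq_bigr => c /m'E ->.
  have e1 := IH _ sm'; rewrite (prodE (fun _ k => k`!)) in e1.
  rewrite (prodE (fun c k => #|[set y | u y == c]| ^ k)%N) in e1.
  rewrite (bigD1 c0) //= [in RHS](bigD1 c0) //= -m'c0 factS expnS; move: e1.
  move: (#|_|) (\prod_(c | _) _)%N (#|_|) (\prod_(c | _) _)%N (m' c0 c0) => A B C D k e1.
  rewrite (_ : C * _ * A = k.+1 * A * (C * (k`! * D)))%N; last by ring.
  by rewrite e1; ring.
rewrite splitE big_distrl /=.
rewrite (partition_big u xpredT) //=.
transitivity (\sum_c m c * (n`! * \prod_c #|[set y | u y == c]| ^ m c))%N; last first.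
  by rewrite -big_distrl /= sm factS mulnA.
apply: eq_bigr => c0 _; have [m0|mp] := posnP (m c0).
  by rewrite m0 mul0n big1 // => y /eqP ->; rewrite m0.
rewrite -termE // mulnC -sum1dep_card big_distrl /=; apply: eq_bigr => y /eqP ->.
by rewrite mp mul1n.
Qed.

Lemma card_ffun_profile (K K' : finType) (u : K -> K') (n : nat) (m : K' -> nat) :
  (\sum_c m c = n)%N ->
  (#|[set h : {ffun 'I_n -> K} | [forall c, #|[set a | u (h a) == c]| == m c]]|
     * \prod_c (m c)`! = n`! * \prod_c #|[set y | u y == c]| ^ m c)%N.
Proof.
move=> /(card_tuple_profile u) <-; congr (_ * _)%N.
pose g (h : {ffun 'I_n -> K}) := [tuple h i | i < n].
rewrite -!sum1_card [RHS](reindex g) /=; last first.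
  exists (fun t => [ffun i => tnth t i]) => [h _|t _].
    by apply/ffunP => i; rewrite ffunE tnth_mktuple.
  by apply: eq_from_tnth => i; rewrite tnth_mktuple ffunE.
apply: eq_bigl => h; rewrite !inE; apply: eq_forallb => c.
rewrite count_map cardsE cardE [in LHS]/enum_mem size_filter -enumT.
by congr (_ == _); apply: eq_count => a.
Qed.

(** * Colourings and the Dowling lattice *)

Lemma partition_merge (T : finType) (P : {set {set T}}) (D B C : {set T}) :
  partition P D -> B \in P -> C \in P -> B != C ->
  partition ((B :|: C) |: (P :\ B :\ C)) D.
Proof.
move=> PP HB HC BC.
have P1 := partitionD1 PP HB.
have HC1 : C \in P :\ B by rewrite !inE eq_sym BC.
have P2 := partitionD1 P1 HC1.
have -> : D = (B :|: C) :|: (D :\: B :\: C).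
  apply/setP => a; rewrite !inE.
  have := subsetP (partitionS PP HC) a; have := subsetP (partitionS PP HB) a.
  by case: (a \in B) => [-> //|_]; case: (a \in C) => [-> //|].
apply: partitionU1 P2 _ _.
  have /set0Pn[a aB] := partition_neq0 PP HB.
  by apply/set0Pn; exists a; rewrite inE aB.
rewrite -setI_eq0; apply/eqP/setP => a; rewrite !inE.
by case: (a \in B); case: (a \in C); rewrite ?andbF.
Qed.

Lemma pblock_in (T : finType) (P : {set {set T}}) (a : T) :
  set0 \notin P -> (pblock P a \in P) = (a \in cover P).
Proof.
move=> P0; apply/idP/idP => [|/pblock_mem //].
by rewrite /pblock; case: pickP => [B /andP[HB aB] _|_ /= /(negP P0) //]; apply/bigcupP; exists B.
Qed.

Section Colourings.

Variables N s m : nat.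
Notation label := 'I_s.-1.+1.
Notation colour := (option ('I_m * label)).
Notation colouring := {ffun 'I_N -> colour}.
Implicit Types (x y : prepart N s) (h : colouring).

(* [None] marks the zero block; the first component of [Some (i, g)] names a
   nonzero block and [g] is the label. *)
Definition shift (g : label) (k : colour) : colour :=
  omap (fun p => (p.1, p.2 + g)) k.

Lemma shift0 k : shift 0 k = k.
Proof. by case: k => [[i g]|] //=; rewrite addr0. Qed.

Lemma shiftD g g' k : shift g (shift g' k) = shift (g' + g) k.
Proof. by case: k => [[i k]|] //=; rewrite addrA. Qed.

Lemma shift_inj g : injective (shift g).
Proof. by apply: (can_inj (g := shift (- g))) => k; rewrite shiftD subrr shift0. Qed.

Definition block_colour h (a : 'I_N) : option 'I_m := omap fst (h a).

Definition colouring_label h : {ffun 'I_N -> label} :=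
  [ffun a => if h a is Some p then p.2 else 0].

Fact colouring_prepart_subproof h :
  is_prepart ([set a | h a == None],
    preim_partition (block_colour h) (~: [set a | h a == None]), colouring_label h).
Proof.
apply/andP; split=> /=; first exact: preim_partitionP.
by apply/forall_inP => a; rewrite inE ffunE => /eqP ->.
Qed.

Definition colouring_prepart h : prepart N s :=
  Prepart (colouring_prepart_subproof h).

(** Order-free form of the relation that [x] lies below the element induced by [h]; [le_compat] and
    [compat_le] are the two directions. *)
Definition compat x h : Prop :=
  (forall a, a \in zero_block x -> h a = None) /\
  (forall B a b, B \in blocks x -> a \in B -> b \in B ->
     shift (- lab x a) (h a) = shift (- lab x b) (h b)).

Lemma compat_colouring_prepart h : compat (colouring_prepart h) h.
Proof.
split=> [a|B a b]; first by rewrite inE => /eqP.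
rewrite /blocks /= => HB aB bB.
have tI := partition_trivIset (prepart_partition (colouring_prepart h)).
have/negP aN : ~ (h a == None).
  have /subsetP/(_ _ aB) := partitionS (prepart_partition (colouring_prepart h)) HB.
  by rewrite !inE => /negP.
have bN : h b != None.
  have /subsetP/(_ _ bB) := partitionS (prepart_partition (colouring_prepart h)) HB.
  by rewrite !inE.
have : b \in pblock (blocks (colouring_prepart h)) a by rewrite (def_pblock tI HB aB).
rewrite pblock_equivalence_partition ?inE //; last by split=> // /eqP ->.
rewrite /block_colour /lab /= !ffunE.
case: (h a) aN => // -[i g] _; case: (h b) bN => // -[j k] _ /= /eqP[->].
by rewrite !subrr.
Qed.

Lemma compat_eqv x y h : prepart_eqv x y -> compat x h -> compat y h.
Proof.
case/and3P=> /eqP zE /eqP bE /forall_inP H [c0 cB]; split=> [a|B a b].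
  by rewrite -zE; exact: c0.
rewrite -bE => HB aB bB; have /existsP[g /forall_inP Hg] := H B HB.
by rewrite (eqP (Hg a aB)) (eqP (Hg b bB)) !opprD -!shiftD (cB B a b).
Qed.

Lemma mem_zero_block_blocks x B a : B \in blocks x -> a \in B -> a \notin zero_block x.
Proof.
by move=> HB aB; have /subsetP/(_ _ aB) := partitionS (prepart_partition x) HB; rewrite inE.
Qed.

Lemma mem_blocks_eq x B C a :
  B \in blocks x -> C \in blocks x -> a \in B -> a \in C -> B = C.
Proof.
have tI := partition_trivIset (prepart_partition x).
by move=> HB HC aB aC; rewrite -(def_pblock tI HB aB) (def_pblock tI HC aC).
Qed.

Lemma compat_merge x y h :
  merge_zero x y || merge_two x y -> compat y h -> compat x h.
Proof.
case/orP=> [/exists_inP[B HB /and3P[/eqP zE /eqP bE /forall_inP lE]]|].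
  case=> c0 cB; split=> [a ax|D a b HD aD bD].
    by apply: c0; rewrite zE inE ax orbT.
  have [DB|nDB] := eqVneq D B.
    by rewrite !c0 // zE inE -DB ?aD ?bD.
  have HD' : D \in blocks y by rewrite bE !inE nDB.
  have := cB D a b HD' aD bD.
  by rewrite !(eqP (lE _ _)) // inE (mem_zero_block_blocks HD').
case/exists_inP=> B HB /exists_inP[C HC] /existsP[g] /and4P[BC /eqP zE /eqP bE /forallP lE].
case=> c0 cB; split=> [a|D a b HD aD bD]; first by rewrite -zE; exact: c0.
have e : shift (- lab y a) (h a) = shift (- lab y b) (h b).
  have [DBC|] := boolP (D \in [set B; C]).
    have BCy : B :|: C \in blocks y by rewrite bE setU11.
    apply: (cB _ _ _ BCy); rewrite inE.
      by case/set2P: DBC => <-; rewrite ?aD ?orbT.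
    by case/set2P: DBC => <-; rewrite ?bD ?orbT.
  rewrite !inE negb_or => /andP[nB nC].
  by apply: (cB D); rewrite // bE !inE nB nC HD orbT.
(* Both points lie in the block [D] of [x], so the merge shifts both labels by [g] or neither, and
   the shift cancels. *)
have ab : (a \in C) = (b \in C).
  by apply/idP/idP => /(mem_blocks_eq HC HD) /(_ _) => [/(_ aD)|/(_ bD)] ->.
move: e; rewrite !(eqP (lE _)) ab; case: (b \in C) => //.
by rewrite !opprD -!shiftD => /shift_inj.
Qed.

Lemma le_compat x h :
  (\pi_(dowling N s) x <= \pi_(dowling N s) (colouring_prepart h))%O -> compat x h.
Proof.
case/connectP=> p; elim: p x => [|c p IH] x /=.
  move=> _ /esym/dowling_piP; rewrite prepart_eqv_sym => /compat_eqv; apply.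
  exact: compat_colouring_prepart.
case/andP=> /existsP[x'] /existsP[y'] /and3P[/eqP/dowling_piP xx' /eqP <- H] /IH{}IH /IH.
by move/(compat_merge H); exact: compat_eqv.
Qed.

(** Climb from [x] by merges that preserve compatibility: a block coloured [None] goes into the zero
    block, and two blocks with the same name are joined. Each merge lowers the number of blocks, and
    when none applies [x] is equivalent to the prepartition induced by [h]. *)
Lemma compat_le x h : compat x h ->
  (\pi_(dowling N s) x <= \pi_(dowling N s) (colouring_prepart h))%O.
Proof.
have [n] := ubnP #|blocks x|; elim: n x => // n IH x /[!ltnS] hn [c0 cB].
have step y : merge_zero x y || merge_two x y -> compat y h ->
    (\pi_(dowling N s) x <= \pi_(dowling N s) (colouring_prepart h))%O.
  move=> H cy; apply: le_trans (merge_le H) _; apply: IH cy.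
  exact: leq_trans (merge_card H) hn.
have Px := prepart_partition x.
have [/exists_inP[B HB /exists_inP[a0 a0B /eqP ha0]]|nNone] :=
    boolP [exists B in blocks x, [exists a in B, h a == None]].
  have Py : is_prepart (B :|: zero_block x, blocks x :\ B,
      [ffun i => if i \in B :|: zero_block x then 0 else lab x i]).
    apply/andP; split=> /=.
      have -> : ~: (B :|: zero_block x) = ~: zero_block x :\: B.
        by apply/setP => j; rewrite !inE negb_or.
      exact: partitionD1.
    by apply/forall_inP => i iI; rewrite ffunE iI.
  apply: (step (Prepart Py)).
    apply/orP; left; apply/exists_inP; exists B => //.
    rewrite /zero_block /= {1}/blocks /= !eqxx /=.
    by apply/forall_inP => i; rewrite inE /lab /= ffunE => /negbTE ->.
  split=> [a|D a b].
    rewrite inE => /orP[aB|]; last exact: c0.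
    by apply: (@shift_inj (- lab x a)); rewrite (cB B a a0) ?ha0.
  rewrite /blocks /lab /= !ffunE => /setD1P[nDB HD] aD bD.
  have nz c : c \in D -> c \in B :|: zero_block x = false.
    move=> cD; rewrite inE (negbTE (mem_zero_block_blocks HD cD)) orbF.
    by apply: contraNF nDB => /(mem_blocks_eq HB HD)/(_ cD) ->.
  by rewrite !nz //; exact: (cB D).
have hN B a : B \in blocks x -> a \in B -> h a != None.
  move=> HB aB; apply: contraNneq nNone => ha.
  by apply/exists_inP; exists B => //; apply/exists_inP; exists a; rewrite ?ha.
have [/exists_inP[B HB /exists_inP[C HC /andP[BC /exists_inP[a0 a0B]]]]|nEq] :=
    boolP [exists B in blocks x, [exists C in blocks x, (B != C) &&
      [exists a in B, [exists b in C, block_colour h a == block_colour h b]]]].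
  case/exists_inP=> b0 b0C; rewrite /block_colour.
  have := hN B a0 HB a0B; have := hN C b0 HC b0C.
  case hb: (h b0) => [[i gb]|] // _; case ha: (h a0) => [[j ga]|] // _ /= /eqP[ij].
  rewrite {}ij {j} in ha.
  (* The difference of the corrected labels on [C] and [B]: relabelling [C] by it makes the
     corrected colour constant on the union. *)
  pose g := gb - lab x b0 - (ga - lab x a0).
  have Py : is_prepart (zero_block x, (B :|: C) |: (blocks x :\ B :\ C),
      [ffun a => if a \in C then lab x a + g else lab x a]).
    apply/andP; split=> /=; first exact: partition_merge.
    apply/forall_inP => a az; rewrite ffunE ifN ?lab_zero //.
    by apply: contraL az; exact: mem_zero_block_blocks.
  apply: (step (Prepart Py)).
    apply/orP; right; apply/exists_inP; exists B => //; apply/exists_inP; exists C => //.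
    apply/existsP; exists g; rewrite BC /zero_block /= {1}/blocks /= !eqxx /=.
    by apply/forallP => a; rewrite {1}/lab /= ffunE.
  split=> [a|D a b]; first exact: c0.
  rewrite /blocks /lab /= !ffunE -/(lab x) => /setU1P[->|].
    have cE c : c \in B :|: C ->
        shift (- (if c \in C then lab x c + g else lab x c)) (h c) =
        Some (i, ga - lab x a0).
      rewrite inE => /orP[cB'|cC].
        rewrite ifN; last by apply: contraNN BC => /(mem_blocks_eq HB HC cB') ->.
        by rewrite (cB B c a0) // ha.
      rewrite cC opprD -shiftD (cB C c b0) // hb /=; congr (Some (_, _)).
      by rewrite /g opprB addrC subrK.
    by move=> aD bD; rewrite !cE.
  rewrite !inE => /and3P[nC nB HD] aD bD.
  have nCD c : c \in D -> c \in C = false.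
    by move=> cD; apply: contraNF nC => /(mem_blocks_eq HC HD)/(_ cD) ->.
  by rewrite !nCD //; exact: (cB D).
suff /dowling_piP -> : prepart_eqv x (colouring_prepart h) by exact: lexx.
have mem_cover a : a \notin zero_block x -> exists2 B, B \in blocks x & a \in B.
  move=> az; have : a \in cover (blocks x) by rewrite (cover_partition Px) inE.
  by case/bigcupP=> B; exists B.
have zE : zero_block x = [set a | h a == None].
  apply/setP => a; rewrite inE; apply/idP/eqP => [/c0 //|ha].
  apply/negPn/negP => /mem_cover[B HB aB].
  by have := hN B a HB aB; rewrite ha.
have bE : blocks x = preim_partition (block_colour h) (~: zero_block x).
  rewrite -{1}(preim_partition_pblock Px); apply: eq_in_imset => a; rewrite inE.
  move=> /mem_cover[B HB aB]; apply/setP => b; rewrite !inE.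
  case bz: (b \in zero_block x) => //=; have /mem_cover[C HC bC] := negbT bz.
  have tI := partition_trivIset Px.
  rewrite (def_pblock tI HB aB) (def_pblock tI HC bC).
  apply/idP/idP => [/eqP BC|ab].
    rewrite -{}BC in bC; have := cB B a b HB aB bC.
    have := hN B a HB aB; have := hN B b HB bC; rewrite /block_colour.
    by case: (h a) => // -[i g] _; case: (h b) => // -[j k] _ [->].
  apply: contraNT nEq => BC; apply/exists_inP; exists B => //.
  apply/exists_inP; exists C => //; rewrite BC /=.
  by apply/exists_inP; exists a => //; apply/exists_inP; exists b.
apply/and3P; split; first by rewrite {2}/zero_block /= zE.
  by rewrite bE zE.
apply/forall_inP => B HB; have /set0Pn[a aB] := partition_neq0 Px HB.
have := hN B a HB aB; case ha: (h a) => [[i g]|] // _.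
apply/existsP; exists (g - lab x a); apply/forall_inP => b bB.
have := cB B a b HB aB bB; rewrite {3}/lab /= ffunE ha.
by case: (h b) => // -[j k] /Some_inj/(congr1 snd)/= ->; rewrite addrCA subrr addr0.
Qed.

(** A compatible colouring amounts to a free choice of one corrected colour per nonzero block, out
    of 1 + m s colours. *)
Lemma card_compat x :
  #|[set h | (\pi_(dowling N s) x <= \pi_(dowling N s) (colouring_prepart h))%O]|
    = ((m * s.-1.+1).+1 ^ #|blocks x|)%N.
Proof.
have Px := prepart_partition x; have tI := partition_trivIset Px.
have b0 : set0 \notin blocks x by have /and3P[] := Px.
pose F (c : {ffun {set 'I_N} -> colour}) : colouring :=
  [ffun a => shift (lab x a) (c (pblock (blocks x) a))].
(* Choices are functions on all subsets with value [None] off the blocks. A point of the zero block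
   has [pblock] equal to [set0], which is no block, so [F] colours it [None]. *)
pose PF := pffun_on (None : colour) (mem (blocks x)) predT.
have -> : ((m * s.-1.+1).+1 ^ #|blocks x|)%N = #|PF|.
  by rewrite card_pffun_on card_option card_prod !card_ord.
rewrite -(card_in_imset (f := F) (D := PF)).
  apply: eq_card => h; rewrite inE; apply/idP/imsetP => [/le_compat[c0 cB]|[c cP ->]].
    pose c := [ffun B => if B \in blocks x then
      if [pick a in B] is Some a then shift (- lab x a) (h a) else None else None].
    exists c.
      by apply/pffun_onP; split=> //; apply/subsetP => B; rewrite !inE ffunE; case: ifP.
    apply/ffunP => a; rewrite !ffunE.
    have [ax|az] := boolP (a \in cover (blocks x)); last first.
      rewrite pblock_in // (negbTE az) c0 //.
      by move: az; rewrite (cover_partition Px) inE negbK.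
    rewrite pblock_mem //; case: pickP => [b bB|/(_ a)]; last by rewrite mem_pblock ax.
    rewrite (cB _ b a _ bB) ?mem_pblock ?pblock_mem //.
    by rewrite shiftD addrC subrr shift0.
  apply: compat_le; split=> [a az|B a b HB aB bB]; rewrite !ffunE.
    have /pffun_onP[/subsetP sub _] := cP.
    suff -> : c (pblock (blocks x) a) = None by [].
    apply/eqP/negPn/negP => /sub /=; apply/negP.
    by rewrite pblock_in // (cover_partition Px) inE negbK.
  by rewrite !(def_pblock tI HB) // !shiftD !subrr.
move=> c1 c2 /pffun_onP[/subsetP s1 _] /pffun_onP[/subsetP s2 _] /ffunP e.
apply/ffunP => B; have [HB|nB] := boolP (B \in blocks x).
  have /set0Pn[a aB] := partition_neq0 Px HB.
  by have := e a; rewrite !ffunE (def_pblock tI HB aB) => /shift_inj.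
have : c1 B = None by apply/eqP/negPn/(contraNN (s1 B)).
have -> : c2 B = None by apply/eqP/negPn/(contraNN (s2 B)).
by [].
Qed.

End Colourings.

(** * Counting balanced colourings *)

Lemma big_option (R : Type) (idx : R) (op : Monoid.com_law idx) (T : finType)
    (F : option T -> R) :
  \big[op/idx]_c F c = op (F None) (\big[op/idx]_x F (Some x)).
Proof.
have e : enum {: option T} = None :: map Some (enum T) by rewrite !enumT [in LHS]unlock.
by rewrite -big_enum e big_cons big_map big_enum.
Qed.

Lemma sum_card_fibers (S T : finType) (f : S -> T) :
  (\sum_c #|[set a | f a == c]| = #|S|)%N.
Proof.
rewrite -sum1_card (partition_big f xpredT) //=.
by apply: eq_bigr => c _; rewrite sum1dep_card.
Qed.

Lemma card_ord_mod (d r n : nat) (j : 'I_d) : (n = d * r)%N ->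
  #|[set g : 'I_n | (g %% d == j)%N]| = r.
Proof.
move=> nE; have d0 : (0 < d)%N := leq_ltn_trans (leq0n j) (ltn_ord j).
have bnd (q : 'I_r) : (q * d + j < n)%N.
  rewrite nE; apply: (@leq_trans (q.+1 * d)); first by rewrite mulSn addnC ltn_add2r.
  by rewrite [leqRHS]mulnC leq_mul2r ltn_ord orbT.
pose f q := Ordinal (bnd q).
have f_inj : injective f.
  by move=> q q' [/eqP]; rewrite eqn_add2r eqn_pmul2r // => /eqP/val_inj.
rewrite -[RHS]card_ord -cardsT -(card_imset _ f_inj); apply: eq_card => g.
rewrite inE; apply/eqP/imsetP => [gj|[q _ ->]].
  have qr : (g %/ d < r)%N by rewrite ltn_divLR // mulnC -nE.
  by exists (Ordinal qr) => //; apply/val_inj; rewrite /= -gj -divn_eq.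
by rewrite /= modnMDl modn_small.
Qed.

Section BalancedColourings.

Variables N d r m : nat.
Hypotheses (d_gt0 : (0 < d)%N) (r_gt0 : (0 < r)%N).
Notation s := (d * r)%N.
Notation label := 'I_s.-1.+1.
Notation colour := (option ('I_m * label)).
Notation colouring := {ffun 'I_N -> colour}.
Implicit Types (h : colouring).

Definition reduce_colour (c : colour) : option ('I_m * 'I_d) :=
  omap (fun p : 'I_m * label => (p.1, Ordinal (ltn_pmod p.2 d_gt0))) c.

Definition colour_fiber h c : {set 'I_N} := [set a | reduce_colour (h a) == c].

Definition balanced_colouring h : bool :=
  [forall i : 'I_m, forall j1 : 'I_d, forall j2 : 'I_d,
    #|colour_fiber h (Some (i, j1))| == #|colour_fiber h (Some (i, j2))|].

Lemma balanced_colouringP h :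
  balanced d d (repr (\pi_(dowling N s) (colouring_prepart h))) =
  balanced_colouring h.
Proof.
have s_gt0 : (0 < s)%N by rewrite muln_gt0 d_gt0.
have eqv : prepart_eqv (repr (\pi_(dowling N s) (colouring_prepart h))) (colouring_prepart h).
  by apply/dowling_piP; exact: reprK.
rewrite (balanced_eqv d s_gt0 _ eqv) ?dvdn_mulr //.
have fibE (B : {set 'I_N}) i (j : 'I_d) :
    B = [set b | block_colour h b == Some i] ->
    [set a in B | (lab (colouring_prepart h) a %% d == j)%N] = colour_fiber h (Some (i, j)).
  move=> ->; apply/setP => a; rewrite !inE /block_colour /lab /= ffunE /reduce_colour.
  by case: (h a) => [[i' g]|].
have blkE a i : block_colour h a = Some i ->
    [set b in ~: [set c | h c == None] | block_colour h a == block_colour h b] =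
    [set b | block_colour h b == Some i].
  move=> ->; apply/setP => b; rewrite !inE /block_colour eq_sym.
  by case: (h b) => [[]|].
have sizeE (B : {set 'I_N}) : (#|B| = \sum_(j < d)
    #|[set a in B | (lab (colouring_prepart h) a %% d == j)%N]|)%N.
  rewrite -sum1_card (partition_big (fun a =>
    Ordinal (ltn_pmod (lab (colouring_prepart h) a) d_gt0)) xpredT) //=.
  by apply: eq_bigr => j _; rewrite -sum1dep_card.
apply/forall_inP/forallP => [bal i|bal _ /imsetP[a + ->]].
  apply/forallP => j1; apply/forallP => j2.
  have [a /eqP ha|none] := pickP (fun a => block_colour h a == Some i).
    have HB : [set b | block_colour h b == Some i] \in blocks (colouring_prepart h).
      rewrite -(blkE a i ha); apply: imset_f; rewrite !inE.
      by move: ha; rewrite /block_colour; case: (h a).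
    have /andP[_ /forallP/(_ j1)/forallP/(_ j2)] := bal _ HB.
    by rewrite !(fibE _ i).
  have fib0 j : colour_fiber h (Some (i, j)) = set0.
    apply/setP => a; rewrite !inE /reduce_colour.
    have := none a; rewrite /block_colour; case: (h a) => [[i' g]|] //= ii'.
    by apply/eqP => -[E _]; rewrite E eqxx in ii'.
  by rewrite !fib0.
rewrite !inE; case ha: (h a) => [[i g]|] // _.
rewrite (blkE a i) /block_colour ?ha //.
have /forallP bali := bal i.
have j0 : 'I_d by exact: Ordinal d_gt0.
apply/andP; split; last first.
  apply/forallP => j1; apply/forallP => j2; rewrite !(fibE _ i) //.
  by have /forallP := bali j1; apply.
rewrite sizeE (eq_bigr (fun=> #|colour_fiber h (Some (i, j0))|)) => [|j _].
  by rewrite sum_nat_const card_ord dvdn_mulr.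
by rewrite (fibE _ i) //; apply/eqP; have /forallP := bali j; apply.
Qed.

End BalancedColourings.

Lemma big_pair_fst (R : Type) (idx : R) (op : Monoid.com_law idx) (I J : finType)
    (F : I -> R) :
  \big[op/idx]_(x : I * J) F x.1 = \big[op/idx]_i \big[op/idx]_(j : J) F i.
Proof. by rewrite pair_bigA. Qed.

Section CountBalanced.

Variables N d r m : nat.
Hypotheses (d_gt0 : (0 < d)%N) (r_gt0 : (0 < r)%N).
Notation s := (d * r)%N.
Notation label := 'I_s.-1.+1.
Notation colour := (option ('I_m * label)).
Notation colouring := {ffun 'I_N -> colour}.
Implicit Types (h : colouring) (k : 'I_m -> nat).

Definition has_profile k h : bool :=
  [forall i : 'I_m, forall j : 'I_d, #|colour_fiber d_gt0 h (Some (i, j))| == k i].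

Lemma sum_colour_fibers h : (#|colour_fiber d_gt0 h None|
  + \sum_(i < m) \sum_(j < d) #|colour_fiber d_gt0 h (Some (i, j))| = N)%N.
Proof.
rewrite -[RHS]card_ord -(sum_card_fibers (fun a => reduce_colour d_gt0 (h a))) big_option.
by rewrite pair_bigA; congr (_ + _)%N; apply: eq_bigr => -[].
Qed.

Lemma sum_profile k h : has_profile k h ->
  (#|colour_fiber d_gt0 h None| + d * \sum_i k i = N)%N.
Proof.
move=> /forallP H; rewrite -[RHS](sum_colour_fibers h); congr (_ + _)%N.
rewrite big_distrr; apply: eq_bigr => i _ /=; have /forallP Hi := H i.
by rewrite (eq_bigr (fun=> k i)) ?sum_nat_const ?card_ord // => j _; apply/eqP.
Qed.

(** Apply the multinomial count to reduced colours: each pair of a name and a residue mod d is the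
    reduction of r colours, and [None] of one only. *)
Lemma card_profile k : (d * \sum_i k i <= N)%N ->
  (#|[set h | has_profile k h]| * ((N - d * \sum_i k i)`! * \prod_i (k i)`! ^ d)
    = N`! * r ^ (d * \sum_i k i))%N.
Proof.
move=> kN; pose p (c : option ('I_m * 'I_d)) := if c is Some x then k x.1 else (N - d * \sum_i k i)%N : nat.
have p_sum : (\sum_c p c = N)%N.
  rewrite big_option /= -[RHS](subnK kN); congr (_ + _)%N.
  rewrite big_distrr big_pair_fst.
  by apply: eq_bigr => i _ /=; rewrite sum_nat_const card_ord.
have := card_ffun_profile (@reduce_colour d r m d_gt0) p_sum.
rewrite !big_option /= (big_pair_fst _ _ (fun i => (k i)`!)) /=.
have -> : (\prod_(i < m) \prod_(j < d) (k i)`! = \prod_(i < m) (k i)`! ^ d)%N.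
  by apply: eq_bigr => i _; rewrite prod_nat_const card_ord.
rewrite (_ : [set h | _] = [set h | has_profile k h]); last first.
  apply/setP => h; rewrite !inE; apply/idP/idP => [/forallP H|H].
  - by apply/forallP => i; apply/forallP => j; exact: (H (Some (i, j))).
  (* The fibres over [Some] determine the size of the fibre over [None]. *)
  - apply/forallP => -[[i j]|]; first by have /forallP/(_ i)/forallP/(_ j) := H.
    by rewrite -(eqn_add2r (d * \sum_i k i)) subnK // (sum_profile H).
move=> ->; congr (_ * _)%N.
rewrite (_ : [set y | _] = [set None]); last first.
  by apply/setP => -[[i g]|]; rewrite !inE.
rewrite cards1 exp1n mul1n.
rewrite (eq_bigr (fun x : 'I_m * 'I_d => r ^ k x.1)%N) => [|[i j] _]; last first.
  congr (_ ^ _)%N; rewrite -[RHS](@card_ord_mod d r s.-1.+1 j) ?prednK ?muln_gt0 ?d_gt0 //.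
  have inj : injective (fun g : label => Some (i, g)) by move=> g g' [].
  rewrite -[RHS](card_imset _ inj); apply: eq_card => -[[i' g]|]; rewrite !inE.
    apply/eqP/imsetP => [[-> gj]|[g' + [-> ->]]]; last first.
      by rewrite inE => /eqP gj; congr (Some (_, _)); apply/val_inj.
    by exists g; rewrite // inE -gj.
  by apply/esym/imsetP => -[].
rewrite (big_pair_fst _ _ (fun i => r ^ k i)%N) big_distrr /= expn_sum.
by apply: eq_bigr => i _; rewrite prod_nat_const card_ord -expnM mulnC.
Qed.

Lemma card_balanced_colouring n e : N = (d * n + e)%N -> (e < d)%N ->
  #|[set h : colouring | balanced_colouring d_gt0 h]| =
  (\sum_(k : {ffun 'I_m -> 'I_n.+1} | \sum_i k i <= n)
    #|[set h | has_profile (fun i => k i) h]|)%N.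
Proof.
move=> NE ed; pose j0 := Ordinal d_gt0.
pose kof h := [ffun i : 'I_m => inord #|colour_fiber d_gt0 h (Some (i, j0))| : 'I_n.+1].
(* As e < d, a bound d y <= d n + e gives y <= n, so [inord] in [kof] never falls back to its
   default. *)
have leN (x y : nat) : (x + d * y = N -> y <= n)%N.
  move=> e1; rewrite -ltnS -(ltn_pmul2l d_gt0) mulnS -ltnS.
  by rewrite ltnS (leq_ltn_trans (leq_addl x _)) // e1 NE addnC ltn_add2r.
have profE h : balanced_colouring d_gt0 h ->
    has_profile (fun i => #|colour_fiber d_gt0 h (Some (i, j0))|) h.
  move=> /forallP H; apply/forallP => i; apply/forallP => j.
  by have /forallP/(_ j)/forallP/(_ j0) := H i.
have kofE h : balanced_colouring d_gt0 h ->
    forall i, kof h i = #|colour_fiber d_gt0 h (Some (i, j0))| :> nat.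
  move=> /profE/sum_profile/leN H i; rewrite ffunE inordK // ltnS (leq_trans _ H) //.
  by rewrite (bigD1 i) //= leq_addr.
rewrite -sum1_card (partition_big kof
    (fun k : {ffun 'I_m -> 'I_n.+1} => \sum_i k i <= n)%N) /=; last first.
  move=> h; rewrite inE => bal; rewrite (eq_bigr _ (fun i _ => kofE h bal i)).
  by have /profE/sum_profile/leN := bal.
apply: eq_bigr => k kn; rewrite sum1dep_card; apply: eq_card => h; rewrite !inE.
apply/andP/idP => [[bal /eqP <-]|H].
  apply/forallP => i; apply/forallP => j; rewrite kofE //.
  by have /profE/forallP/(_ i)/forallP/(_ j) := bal.
have HE i j : #|colour_fiber d_gt0 h (Some (i, j))| = k i.
  by have /forallP/(_ i)/forallP/(_ j)/eqP := H.
split.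
  by apply/forallP => i; apply/forallP => j1; apply/forallP => j2; rewrite !HE.
by apply/eqP/ffunP => i; rewrite ffunE HE inord_val.
Qed.

End CountBalanced.

(** If the profile has sum j, the zero block has d (n - j) + e points and yields the factor of [w],
    while each name yields a coefficient of [c]. Of the r ^ (d j) label choices, r ^ ((d - 1) j) is
    absorbed by the normalisation of [w] and r ^ j goes to [c]. *)
Lemma balanced_colouring_series (d r e n m : nat) (d_gt0 : (0 < d)%N) :
  (0 < r)%N -> (e < d)%N ->
  let w : fps := fun n =>
    (e`! * d ^ n)%N%:R / ((d * n + e)`! * r ^ ((d - 1) * n))%N%:R in
  let c : fps := fun n => (d ^ n * r ^ n)%N%:R / (n`! ^ d)%N%:R in
  #|[set h : {ffun 'I_(d * n + e) -> option ('I_m * 'I_(d * r).-1.+1)} |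
       balanced_colouring d_gt0 h]|%:R * w n = fps_mul w (fps_exp c m) n.
Proof.
move=> r_gt0 ed w c.
pose W (k : {ffun 'I_m -> 'I_n.+1}) := (\sum_i k i)%N.
have termE (k : {ffun 'I_m -> 'I_n.+1}) : (W k <= n)%N ->
    #|[set h : {ffun 'I_(d * n + e) -> option ('I_m * 'I_(d * r).-1.+1)} |
        has_profile d_gt0 (fun i => k i) h]|%:R * w n = w (n - W k)%N * \prod_i c (k i).
  move=> kn; have kN : (d * W k <= d * n + e)%N.
    by rewrite (leq_trans _ (leq_addr _ _)) // leq_pmul2l.
  have := card_profile d_gt0 r_gt0 kN; rewrite -/(W k).
  rewrite big_split /= prodfV -!natr_prod.
  have -> : (\prod_i (d ^ k i * r ^ k i) = d ^ W k * r ^ W k)%N.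
    by rewrite big_split /= -!expn_sum.
  have Q0 : (\prod_i (k i)`! ^ d)%N%:R != 0 :> rat.
    by rewrite pnatr_eq0 -lt0n prodn_gt0 // => i; rewrite expn_gt0 fact_gt0.
  move: (#|_|) (\prod_i (k i)`! ^ d)%N (W k) kn kN Q0 => A Q j jn jN Q0.
  rewrite /w (_ : (d * n + e - d * j = d * (n - j) + e)%N); last first.
    by rewrite mulnBr addnBAC // leq_mul2l jn orbT.
  have -> : (r ^ (d * j) = r ^ ((d - 1) * j) * r ^ j)%N.
    by rewrite -expnD -[X in (_ + X)%N]mul1n -mulnDl subnK.
  have [-> ->] : (d ^ n = d ^ j * d ^ (n - j) /\
      r ^ ((d - 1) * n) = r ^ ((d - 1) * j) * r ^ ((d - 1) * (n - j)))%N.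
    by rewrite -!expnD -mulnDr subnKC.
  move=> /(congr1 (fun x => x%:R : rat)); rewrite !natrM.
  have [f1 f2] : ((d * n + e)`!%:R != 0 :> rat) /\ ((d * (n - j) + e)`!%:R != 0 :> rat).
    by rewrite !pnatr_eq0 -!lt0n !fact_gt0.
  have rX i : (r ^ i)%N%:R != 0 :> rat by rewrite pnatr_eq0 expn_eq0 negb_and -lt0n r_gt0.
  move=> AE; have -> : A%:R = (d * n + e)`!%:R * ((r ^ ((d - 1) * j))%N%:R * (r ^ j)%N%:R)
      / ((d * (n - j) + e)`!%:R * Q%:R) :> rat by rewrite -AE mulfK // mulf_neq0.
  by field; rewrite f1 f2 Q0 !rX.
rewrite (@card_balanced_colouring _ d r m d_gt0 n e (erefl _) ed) natr_sum mulr_suml.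
rewrite (eq_bigr _ termE) (partition_big (fun k => inord (W k) : 'I_n.+1) xpredT) //=.
rewrite /fps_mul [RHS](reindex_inj rev_ord_inj) /=.
apply: eq_bigr => j _; have jn : (j <= n)%N by rewrite -ltnS.
rewrite subSS subKn // (@fps_exp_sum _ _ n) //.
rewrite mulr_sumr; apply: eq_big => [k|k /andP[kn /eqP <-]].
  apply/andP/eqP => [[kn /eqP <-]|kj]; first by rewrite inordK.
  by rewrite /W kj; split=> //; apply/eqP/val_inj; rewrite /= inordK.
by rewrite inordK.
Qed.

(** * Balanced elements form an upper set *)

Section UpwardClosed.

Variables N s d k : nat.
Hypotheses (s_gt0 : (0 < s)%N) (ks : (k %| s)%N).

(* When [B] and [C] merge, relabelling [x] by [lab y] gives an equivalent
   prepartition, and the counts of its blocks [B] and [C] add up. *)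
Lemma balanced_merge (x y : prepart N s) :
  merge_zero x y || merge_two x y -> balanced d k x -> balanced d k y.
Proof.
case/orP=> [/exists_inP[B HB /and3P[/eqP zE /eqP bE /forall_inP lE]]|].
  move=> /forall_inP bal; apply/forall_inP => D HD.
  have /andP[-> /= /forallP H] : (d %| #|D|)%N && [forall j1 : 'I_k, forall j2 : 'I_k,
      #|[set a in D | (lab x a %% k == j1)%N]| == #|[set a in D | (lab x a %% k == j2)%N]|].
    by apply: bal; move: HD; rewrite bE => /setD1P[].
  have fE (j : 'I_k) : [set a in D | (lab y a %% k == j)%N] = [set a in D | (lab x a %% k == j)%N].
    apply/setP => a; rewrite !inE; case aD: (a \in D) => //=.
    by rewrite (eqP (lE a _)) // inE (mem_zero_block_blocks HD).
  by apply/forallP => j1; apply/forallP => j2; rewrite !fE; have /forallP := H j1; apply.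
case/exists_inP=> B HB /exists_inP[C HC] /existsP[g] /and4P[BC /eqP zE /eqP bE /forallP lE].
have Px' : is_prepart (zero_block x, blocks x, lab y).
  apply/andP; split=> /=; first exact: prepart_partition.
  by apply/forall_inP => a; rewrite -zE => /lab_zero ->.
rewrite (@balanced_eqv _ _ _ _ _ (Prepart Px')) //; last first.
  rewrite /prepart_eqv !eqxx; apply/forall_inP => D HD.
  apply/existsP; exists (if D == C then g else 0); apply/forall_inP => a aD.
  rewrite {1}/lab /= (eqP (lE a)) -/(lab x); have [<-|DC] := eqVneq D C.
    by rewrite aD.
  rewrite ifN ?addr0 //; apply: contraNN DC => /(mem_blocks_eq HC HD)/(_ aD) ->.
  exact: eqxx.
move=> /forall_inP bal; apply/forall_inP => D; rewrite bE => /setU1P[->|]; last first.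
  by rewrite !inE => /and3P[_ _ HD]; exact: (bal D).
have /andP[dB /forallP HB'] := bal B HB; have /andP[dC /forallP HC'] := bal C HC.
have BC0 : B :&: C = set0.
  apply/setP => a; rewrite !inE; apply/negP => /andP[aB aC].
  by rewrite (mem_blocks_eq HB HC aB aC) eqxx in BC.
apply/andP; split; first by rewrite cardsU BC0 cards0 subn0 dvdn_add.
have cE (j : 'I_k) : #|[set a in B :|: C | (lab y a %% k == j)%N]| =
    (#|[set a in B | (lab y a %% k == j)%N]| + #|[set a in C | (lab y a %% k == j)%N]|)%N.
  pose Y := [set a | (lab y a %% k == j)%N].
  have IE (D' : {set 'I_N}) : [set a in D' | (lab y a %% k == j)%N] = D' :&: Y.
    by apply/setP => a; rewrite !inE.
  by rewrite !IE setIUl cardsU setIACA BC0 set0I cards0 subn0.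
apply/forallP => j1; apply/forallP => j2; rewrite !cE; apply/eqP; congr (_ + _)%N; apply/eqP.
  by have /forallP := HB' j1; apply.
by have /forallP := HC' j1; apply.
Qed.

Lemma balanced_le (u v : dowling N s) :
  (u <= v)%O -> balanced d k (repr u) -> balanced d k (repr v).
Proof.
have reprE (x : prepart N s) : balanced d k (repr (\pi_(dowling N s) x)) = balanced d k x.
  by apply: balanced_eqv => //; apply/dowling_piP; exact: reprK.
case/connectP=> p; elim: p u => [|c p IH] u /=; first by move=> _ ->.
case/andP=> /existsP[x] /existsP[y] /and3P[/eqP <- /eqP <- H] /IH{}IH /IH{}IH.
by move=> bal; apply: IH; move: bal; rewrite !reprE; exact: balanced_merge.
Qed.

End UpwardClosed.

(** * Colouring polynomials and the Möbius number *)

Lemma dowling_blocks_eq0 N s (v : dowling N s) :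
  (#|blocks (repr v)| == 0)%N = (v == \top%O).
Proof.
apply/idP/eqP => [v0|->]; last by rewrite blocks_repr cards0.
by case: (dowling_le_card (lex1 v)) => //; rewrite (eqP v0) ltn0.
Qed.

(** The polynomials are defined by prescribing their upper sums (1 + s X) ^ l, with l the number of
    nonzero blocks. At a natural m these are the counts of [card_compat]; at - 1 / s the base is 0,
    and 0 ^ l survives only for l = 0, that is at the top. *)
Lemma dowling_colouring_poly N s : (0 < s)%N ->
  exists p : dowling N s -> {poly rat},
    (forall m z, (p z).[m%:R] =
       #|[set h : {ffun 'I_N -> option ('I_m * 'I_s.-1.+1)} |
            \pi_(dowling N s) (colouring_prepart h) == z]|%:R) /\
    (forall v, \sum_(z : dowling N s | (v <= z)%O) (p z).[- (1 / s%:R)]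
       = (v == \top%O)%:R).
Proof.
move=> s_gt0.
have [p pE] := @upper_sum_solvable _ (dowling N s) {poly rat}
  (fun v => (1 + s%:R%:P * 'X) ^+ #|blocks (repr v)|).
have hE v a : \sum_(z : dowling N s | (v <= z)%O) (p z).[a] =
    (1 + s%:R * a) ^+ #|blocks (repr v)|.
  by rewrite -horner_sum pE horner_exp !hornerE.
exists p; split=> [m z|v]; last first.
  rewrite hE div1r mulrN divff ?pnatr_eq0 -?lt0n // subrr expr0n.
  by rewrite dowling_blocks_eq0.
move: z; apply: upper_sum_inj => v; rewrite hE -natr_sum.
pose Phi (h : {ffun 'I_N -> option ('I_m * 'I_s.-1.+1)}) :=
  \pi_(dowling N s) (colouring_prepart h).
transitivity (#|[set h | (v <= Phi h)%O]|%:R : rat).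
  by rewrite -{2}[v]reprK card_compat prednK // natrX -addn1 natrD natrM addrC mulrC.
congr (_%:R); rewrite -sum1_card (partition_big Phi (fun z => v <= z)%O) /=; last first.
  by move=> h; rewrite inE.
apply: eq_bigr => z vz; rewrite sum1dep_card; apply: eq_card => h; rewrite !inE.
by apply/andP/idP => [[]|/eqP hz] //; have -> : Phi h = z by []; rewrite vz eqxx.
Qed.

(** Above a balanced element everything is balanced, so its upper sum in the subposet equals the one
    in the whole lattice and [mu_upper_sum] applies. *)
Lemma mu_dowling_sub_sum (N s d : nat) (f : dowling N s -> rat) :
  (0 < s)%N -> (d %| s)%N ->
  (forall v, \sum_(z : dowling N s | (v <= z)%O) f z = (v == \top%O)%:R) ->
  (mu_dowling_sub N s d d)%:~R = - \sum_(z : dowling N s | balanced d d (repr z)) f z.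
Proof.
move=> s_gt0 ds fE.
pose S := dowling_sub N s d d.
have sum_sub (A : pred (dowling N s)) : (forall z, A z -> balanced d d (repr z)) ->
    \sum_(z : S | A (val z)) f (val z) = \sum_(z | A z) f z.
  move=> AB; rewrite [RHS](reindex_omap (val : S -> dowling N s) insub) /=.
    by apply: eq_bigl => z; rewrite valK eqxx andbT.
  by move=> z /AB bz; rewrite insubT ?bz ?orbT.
have topB : balanced d d (repr (\top%O : dowling N s)).
  by apply/forall_inP => B; rewrite blocks_repr inE.
rewrite /mu_dowling_sub; case: ifP => [Nd|/norP[N0 d1]].
  have allB (x : prepart N s) : balanced d d x.
    apply/forall_inP => B HB; case/orP: Nd => [/eqP N0|/eqP d1].
      have /set0Pn[a _] := partition_neq0 (prepart_partition x) HB.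
      by have := ltn_ord a; rewrite {2}N0.
    rewrite {1}d1 dvd1n /=; apply/forallP => j1; apply/forallP => j2.
    by have -> : j1 = j2 by apply/val_inj => /=; have := ltn_ord j1; have := ltn_ord j2; lia.
  (* Here every element is balanced, including the old minimum; the adjoined one is the bottom and
     carries the value 0. *)
  pose g (z : with_bot S) : rat := if z is Some y then f (val y) else 0.
  rewrite (@mu_upper_sum _ _ (with_bot S) g) // => [|[w|] // _].
    congr (- _); rewrite big_mkcond [LHS]big_option /= add0r.
    rewrite -(sum_sub (fun z => balanced d d (repr z))) //.
    by apply: eq_bigl => z; rewrite allB.
  rewrite big_mkcond [LHS]big_option /= add0r -big_mkcond /=.
  rewrite -[RHS](fE (val w)) -sum_sub //.
(* Here N > 0 and d > 1, so the singleton blocks of the bottom violate divisibility by d: the bottom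
   is the only unbalanced element of [S]. *)
have botNB : ~~ balanced d d (repr (\bot%O : dowling N s)).
  apply: contra d1 => /forall_inP bal.
  have N_gt0 : (0 < N)%N by rewrite lt0n.
  have /bal/andP[] : [set Ordinal N_gt0] \in blocks (repr (\bot%O : dowling N s)).
    by rewrite blocks_repr; apply: imset_f.
  by rewrite cards1 dvdn1.
have balE (z : S) : (z != \bot%O) = balanced d d (repr (val z)).
  have := valP z; rewrite -val_eqE /=; have [->|] := eqVneq (val z) \bot%O => //=.
  by rewrite (negbTE botNB).
rewrite (@mu_upper_sum _ _ S (f \o val)).
- by congr (- _); rewrite -(sum_sub (fun z => balanced d d (repr z))) //; apply: eq_bigl.
- by rewrite eq_sym balE.
- move=> w; rewrite balE -val_eqE -(fE (val w)) => bw.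
  by rewrite -sum_sub // => z wz; apply: balanced_le wz bw.
Qed.

Theorem corollary4p10 (d r e : nat)
    (hd : (1 <= d)%N) (hr : (1 <= r)%N) (he : (e < d)%N) :
  let w : fps := fun n =>
    (e`! * d ^ n)%N%:R / ((d * n + e)`! * r ^ ((d - 1) * n))%N%:R in
  let c : fps := fun n => (d ^ n * r ^ n)%N%:R / (n`! ^ d)%N%:R in
  forall n : nat,
    (mu_dowling_sub (d * n + e) (d * r) d d)%:~R * w n
    = - fps_mul w (fps_pow c (- (1 / (d * r)%N%:R))) n.
Proof.
move=> w c n.
have s_gt0 : (0 < d * r)%N by rewrite muln_gt0 hd.
have [p [p_nat p_root]] := dowling_colouring_poly (d * n + e) s_gt0.
have [q qE] := fps_pow_poly c.
rewrite (mu_dowling_sub_sum s_gt0 (dvdn_mulr _ (dvdnn d)) p_root) mulNr; congr (- _).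
(* [P] and [Q] are the two sides, up to sign, with - 1 / s replaced by an indeterminate; at a
   natural m both count balanced colourings, weighted by [w n]. *)
pose P := (\sum_(z : dowling (d * n + e) (d * r) | balanced d d (repr z)) p z) * (w n)%:P.
pose Q := \sum_(i < n.+1) (w i)%:P * q (n - i)%N.
have PE a : P.[a] =
    (\sum_(z : dowling (d * n + e) (d * r) | balanced d d (repr z)) (p z).[a]) * w n.
  by rewrite hornerM hornerC horner_sum.
have QE a : Q.[a] = fps_mul w (fps_pow c a) n.
  by rewrite horner_sum; apply: eq_bigr => i _; rewrite hornerM hornerC qE.
rewrite -PE -QE; congr (_.[_]); apply: poly_nat_inj => m.
have c0 : c 0%N = 1 by rewrite /c !expn0 exp1n divr1.
rewrite PE QE; transitivity (fps_mul w (fps_exp c m) n); last first.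
  by apply: eq_bigr => i _; rewrite fps_pow_nat.
rewrite -(balanced_colouring_series n m hd hr he) -/w; congr (_ * _).
rewrite (eq_bigr _ (fun z _ => p_nat m z)) -natr_sum; congr (_%:R).
rewrite -[RHS]sum1_card (partition_big (fun h => \pi_(dowling (d * n + e) (d * r))
  (colouring_prepart h)) (fun z => balanced d d (repr z))) /=; last first.
  by move=> h; rewrite inE -balanced_colouringP.
apply: eq_bigr => z bz; rewrite -sum1dep_card; apply: eq_bigl => h; rewrite inE.
by rewrite -balanced_colouringP //; case: eqP => [->|]; rewrite ?bz ?andbF.
Qed.
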